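(* Let $\mathcal S=\{G\in\operatorname{Sym}_2^+(\mathbb R):\det G=1\}$, let $\Theta=(p,q,r):\mathcal S\to\mathbb R^3$, $\Theta(G)=\bigl(E_{(1,0)}(G),E_{(0,1)}(G),E_{(1,1)}(G)\bigr)$, and let $g_R=\Theta^*g_{\mathbb R^3}$, as in the context. On $\mathbb R^3$ with coordinates $(p,q,r)$ use the orthogonal change of coordinates $$U=\frac{p+q+r}{\sqrt3},\qquad V=\frac{p-q}{\sqrt2},\qquad W=\frac{p+q-2r}{\sqrt6}.$$ Then $\Theta$ is a smooth embedding of $\mathcal S$ onto $$\mathcal H_R=\{(U,V,W):U^2-2V^2-2W^2=1,\ U>0\},$$ and $g_R$ is (under this identification) the Riemannian metric induced on $\mathcal H_R$ by the Euclidean metric of $\mathbb R^3$.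
   Context: $\operatorname{Sym}_2^+(\mathbb R)$ is the set of real symmetric positive-definite $2\times2$ matrices. Let $T^2=\mathbb R^2/\mathbb Z^2$, and for $G\in\operatorname{Sym}_2^+(\mathbb R)$ let $g_G$ be the constant (flat) Riemannian metric on $T^2$ with matrix $G$. $\mathcal S$, the space of marked unit-volume flat metrics, is a smooth two-dimensional manifold with $T_G\mathcal S=\{H\in\operatorname{Sym}_2(\mathbb R):\operatorname{tr}(G^{-1}H)=0\}$. For $m=(m_1,m_2)\in\mathbb Z^2$ let $u_m:T^2\to S^1=\mathbb R/\mathbb Z$, $u_m(x)=m_1x^1+m_2x^2\pmod{\mathbb Z}$, where $S^1$ carries its flat metric, and let $E_m(G)=\frac12\int_{T^2}|du_m|^2_{g_G}\,dV_{g_G}=\frac12 m^TG^{-1}m$ be its energy. $g_{\mathbb R^3}$ is the Euclidean metric on $\mathbb R^3$. *)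

(* Defs.v *)
From mathcomp Require Import all_boot all_order all_algebra.
From mathcomp Require Import all_classical all_reals all_analysis.

Set Implicit Arguments.
Unset Strict Implicit.
Unset Printing Implicit Defensive.
Import Order.TTheory GRing.Theory Num.Theory.
Import numFieldNormedType.Exports.
Local Open Scope classical_set_scope.
Local Open Scope ring_scope.

(** Smooth maps and submanifolds of finite-dimensional normed spaces, for
    arbitrary subsets [A] of such spaces: a map on [A] is smooth when it
    extends smoothly to a neighbourhood of each point of [A], and only its
    values on [A] matter. *)

Section SubsetsOfNormedSpaces.
Context {R : realType}.

(* C^oo on an open set: every iterated directional derivative
   D_v1 (D_v2 (... f)) is differentiable at every point. *)
Definition smooth_on {V W : normedModType R} (U : set V) (f : V -> W) : Prop :=
  forall (vs : seq V) (x : V), U x ->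
    differentiable (foldr (fun v g => 'D_v g) f vs) x.

Definition smooth_map {V W : normedModType R} (A : set V) (f : V -> W) : Prop :=
  forall x, A x -> exists (U : set V) (F : V -> W),
    [/\ open U, U x, smooth_on U F & forall y, A y -> U y -> F y = f y].

Definition diffeomorphism {V W : normedModType R} (A : set V) (B : set W)
    (f : V -> W) : Prop :=
  [/\ smooth_map A f, f @` A = B &
      exists g : W -> V, smooth_map B g /\ forall x, A x -> g (f x) = x].

Definition submanifold {V : normedModType R} (d : nat) (X : set V) : Prop :=
  forall x, X x -> exists (U : set V) (O : set 'rV[R]_d) (phi : 'rV[R]_d -> V),
    [/\ open U, U x, open O & diffeomorphism O (X `&` U) phi].

Definition curve_at {V : normedModType R} (X : set V) (x : V) (c : R -> V)
    : Prop :=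
  c 0 = x /\ exists I : set R,
    [/\ open I, I 0, smooth_on I c & forall t, I t -> X (c t)].

Definition tangent {V : normedModType R} (X : set V) (x : V) : set V :=
  [set v | exists c : R -> V, curve_at X x c /\ derive1 c 0 = v].

(* The differential at [x] of the restriction of [f] to the submanifold [X]:
   the velocity c'(0) of a curve c in X is sent to (f o c)'(0). The value is
   meaningful for v tangent to X and f smooth on X, in which case it does not
   depend on c. *)
Definition differential {V W : normedModType R} (X : set V) (f : V -> W)
    (x v : V) : W :=
  xget 0 [set w | exists c : R -> V,
    [/\ curve_at X x c, derive1 c 0 = v & derive1 (f \o c) 0 = w]].

Definition topological_embedding {V W : normedModType R} (X : set V)
    (f : V -> W) : Prop :=
  {within X, continuous f} /\ exists g : W -> V,
    {within f @` X, continuous g} /\ forall x, X x -> g (f x) = x.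

Definition immersion {V W : normedModType R} (X : set V) (f : V -> W) : Prop :=
  smooth_map X f /\
  forall x, X x -> set_inj (tangent X x) (differential X f x).

Definition smooth_embedding {V W : normedModType R} (d : nat) (X : set V)
    (f : V -> W) : Prop :=
  [/\ submanifold d X, immersion X f & topological_embedding X f].

(* A Riemannian metric on X is given by a family of bilinear forms
   [g x : V -> V -> R], of which only the values on [tangent X x], for x in X,
   are relevant. In particular the metric induced on a submanifold by a metric
   of the ambient space is represented by the same family. *)
Definition metric_on (V : Type) : Type := V -> V -> V -> R.

Definition pullback {V W : normedModType R} (X : set V) (f : V -> W)
    (h : metric_on W) : metric_on V :=
  fun x v w => h (f x) (differential X f x v) (differential X f x w).

Definition riemannian_isometry {V W : normedModType R} (d : nat)
    (X : set V) (g : metric_on V) (Y : set W) (h : metric_on W)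
    (f : V -> W) : Prop :=
  [/\ submanifold d X, submanifold d Y, diffeomorphism X Y f &
      forall x v w, X x -> tangent X x v -> tangent X x w ->
        g x v w = pullback X f h x v w].

Definition euclidean {n : nat} : metric_on 'rV[R]_n :=
  fun _ v w => \sum_(i < n) v 0 i * w 0 i.

End SubsetsOfNormedSpaces.

Section FlatTori.
Context {R : realType}.

Definition sym_posdef (G : 'M[R]_2) : Prop :=
  G^T = G /\ forall x : 'rV[R]_2, x != 0 -> 0 < (x *m G *m x^T) 0 0.

Definition unit_volume_metrics : set 'M[R]_2 :=
  [set G | sym_posdef G /\ \det G = 1].

Definition row2 (x y : R) : 'rV[R]_2 := \row_(i < 2) [:: x; y]`_i.
Definition row3 (x y z : R) : 'rV[R]_3 := \row_(i < 3) [:: x; y; z]`_i.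

(* A map from T^2 = R^2/Z^2 to R/Z is represented by a lift u : R^2 -> R; its
   differential is that of u, as a row of partial derivatives. *)
Definition differential_row (u : 'rV[R]_2 -> R) (x : 'rV[R]_2) : 'rV[R]_2 :=
  \row_(j < 2) 'D_(delta_mx 0 j) u x.

Definition conorm_sq (G : 'M[R]_2) (a : 'rV[R]_2) : R :=
  (a *m invmx G *m a^T) 0 0.

(* The Dirichlet energy, with T^2 represented by the fundamental domain
   [0, 1]^2 and dV = sqrt (det G) dx^1 dx^2. *)
Definition energy (G : 'M[R]_2) (u : 'rV[R]_2 -> R) : R :=
  2^-1 * Rintegral (lebesgue_measure \x lebesgue_measure)%E
    (`[0, 1] `*` `[0, 1] : set (R * R))
    (fun x => conorm_sq G (differential_row u (row2 x.1 x.2))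
              * Num.sqrt (\det G)).

Definition mode (m : int * int) (x : 'rV[R]_2) : R :=
  m.1%:~R * x 0 0 + m.2%:~R * x 0 1.

Definition mode_energy (m : int * int) (G : 'M[R]_2) : R :=
  energy G (mode m).

(* Only the values on unit_volume_metrics matter: tangent, differential, etc.
   never look at a function outside the given subset. *)
Definition Theta (G : 'M[R]_2) : 'rV[R]_3 :=
  row3 (mode_energy (1, 0) G) (mode_energy (0, 1) G) (mode_energy (1, 1) G).

Definition gR : metric_on 'M[R]_2 :=
  pullback unit_volume_metrics Theta euclidean.

Definition UVW (y : 'rV[R]_3) : 'rV[R]_3 :=
  let p := y 0 0 in let q := y 0 1 in let r := y 0 2 in
  row3 ((p + q + r) / Num.sqrt 3) ((p - q) / Num.sqrt 2)
       ((p + q - 2 * r) / Num.sqrt 6).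

Definition orthogonal_map {n : nat} (f : 'rV[R]_n -> 'rV[R]_n) : Prop :=
  exists2 Q : 'M[R]_n, Q *m Q^T = 1%:M & forall y, f y = y *m Q.

(* In the coordinates (U, V, W). *)
Definition HR : set 'rV[R]_3 :=
  [set y | y 0 0 ^+ 2 - 2 * y 0 1 ^+ 2 - 2 * y 0 2 ^+ 2 = 1 /\ 0 < y 0 0].

End FlatTori.

(* Main.v *)
From HB Require Import structures.
Require Import Defs.
From mathcomp Require Import all_boot all_order all_algebra.
From mathcomp Require Import all_classical all_reals all_analysis.
From mathcomp Require Import ring lra.
Import Order.TTheory GRing.Theory Num.Theory.
Import numFieldNormedType.Exports.
Local Open Scope classical_set_scope.
Local Open Scope ring_scope.

Set Implicit Arguments.
Unset Strict Implicit.
Unset Printing Implicit Defensive.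

(** For G = [[a, b], [b, c]] of determinant 1 the inverse is [[c, -b], [-b, a]],
    so Theta is on the surface det G = 1 the restriction of a linear map, namely
    (a, b, c) |-> (c, a, a + c - 2 b) / 2, which is invertible on symmetric
    matrices. Hence Theta and its inverse are smooth, and the differential of
    Theta is the linear map itself. The equation a c - b^2 = 1 becomes
    4 p q - (p + q - r)^2 = 1, which is the hyperboloid in the orthonormal
    coordinates (U, V, W), and the sheet a > 0 is the sheet U > 0. Solving for
    c = (1 + b^2) / a parametrizes both surfaces by a rational map defined on
    the half-plane a > 0, inverse to a linear projection. *)

(** * Smoothness of linear and rational maps *)

Section Smoothness.
Context {R : realType}.
Implicit Types V W : normedModType R.

(** The first-order expansion of [f] at [x] is also one of [g]; by uniqueness of the differential,
    ['d f x] is then the differential of [g]. *)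
Lemma near_eq_differentiable V W (f g : V -> W) (x : V) :
  {near x, f =1 g} -> differentiable f x -> differentiable g x.
Proof.
move=> fg df; have fgx := nbhs_singleton fg.
have dg : continuous ('d f x) /\ (g \o shift x = cst (g x) + 'd f x +o_ 0 id).
  have /diff_locallyP[cf ef] := df; split=> //; rewrite -fgx.
  apply/eqaddoP => e e0; have /eqaddoP/(_ e e0) := ef.
  have: \forall h \near 0, f (h + x) = g (h + x).
    by have := fg; rewrite (near_shift 0) /= subr0; apply: filterS.
  by apply: filterS2 => h /= fgh; rewrite !fctE /= fgh.
have Ed := diff_unique dg.1 dg.2.
by apply/diff_locallyP; rewrite Ed.
Qed.

(** Coinduction: each iterated derivative of [f] agrees on [U] with a member of [C]. Agreement on
    [U] suffices because [U] is open and derivatives are local. *)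
Lemma smooth_on_coind V W (U : set V) (C : (V -> W) -> Prop) :
  open U ->
  (forall f, C f -> forall x, U x -> differentiable f x) ->
  (forall f v, C f -> exists2 g, C g & forall x, U x -> 'D_v f x = g x) ->
  forall f, C f -> smooth_on U f.
Proof.
move=> oU Cdiff Cder f Cf vs x Ux.
suff [g Cg fg] : exists2 g, C g &
    forall y, U y -> foldr (fun v g => 'D_v g) f vs y = g y.
  apply: (@near_eq_differentiable _ _ g); last exact: Cdiff.
  by near do rewrite fg//; exact: open_nbhs_nbhs.
elim: vs => [|v vs [g Cg fg]] /=; first by exists f.
have [h Ch gh] := Cder _ v Cg; exists h => // y Uy.
rewrite -gh//; apply: near_eq_derive.
by near do rewrite fg//; exact: open_nbhs_nbhs.
Unshelve. all: by end_near. Qed.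

(** Expansion over the matrix units turns [f] into a finite sum of coordinates times fixed
    vectors. *)
Lemma mx_linear_continuous m n W (f : {linear 'M[R]_(m, n) -> W}) :
  continuous f.
Proof.
have -> : f = (fun A => \sum_i \sum_j A i j *: f (delta_mx i j)) :> (_ -> _).
  apply/funext => A; rewrite {1}(matrix_sum_delta A) linear_sum.
  apply: eq_bigr => i _; rewrite linear_sum.
  by apply: eq_bigr => j _; rewrite linearZ.
apply: (continuous_big (op := +%R)) => [|i _]; first exact: add_continuous.
apply: (continuous_big (op := +%R)) => [|j _ A]; first exact: add_continuous.
have := @coord_continuous R m n i j A.
by apply: (@cvgZr_tmp _ _ _ (nbhs A)); exact: nbhs_filter.
Qed.

Lemma derive_linear_comp V W W' (L : {linear W -> W'}) (F : V -> W) x v :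
  continuous L -> differentiable F x -> 'D_v (L \o F) x = L ('D_v F x).
Proof.
move=> cL dF; have dL := @linear_differentiable _ _ _ L (F x) cL.
rewrite !deriveE//; last exact: differentiable_comp.
by rewrite diff_comp// diff_lin.
Qed.

Lemma smooth_on_linear_comp V W W' (U : set V) (L : {linear W -> W'})
    (F : V -> W) :
  open U -> continuous L -> smooth_on U F -> smooth_on U (L \o F).
Proof.
move=> oU cL sF.
apply: (@smooth_on_coind _ _ _
  (fun f => exists2 G, smooth_on U G & f = L \o G)) => //.
- move=> _ [G sG ->] x Ux; apply: differentiable_comp; first exact: (sG [::]).
  exact: linear_differentiable.
- move=> _ v [G sG ->]; exists (L \o 'D_v G).
    (* Appending [v] to the list of directions makes it the innermost derivative. *)
    exists ('D_v G) => // vs x Ux; have := sG (rcons vs v) x Ux.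
    by rewrite foldr_rcons.
  by move=> x Ux; rewrite derive_linear_comp//; exact: (sG [::]).
- by exists F.
Qed.

(** Derivatives of a linear map are constant, so [L] and the constants form a class closed under
    differentiation. *)
Lemma smooth_on_linear V W (U : set V) (L : {linear V -> W}) :
  open U -> continuous L -> smooth_on U L.
Proof.
move=> oU cL.
apply: (@smooth_on_coind _ _ _ (fun f => f = L \/ exists w, f = cst w)) => //.
- by move=> f [->|[w ->]] x _ //; exact: linear_differentiable.
- move=> f v [->|[w ->]].
    exists (cst (L v)); first by right; exists (L v).
    by move=> x _; rewrite deriveE ?diff_lin//; exact: linear_differentiable.
  by exists (cst 0); [right; exists 0|move=> x _; rewrite derive_cst].
- by left.
Qed.

Lemma smooth_map_linear V W (A : set V) (f : V -> W) (L : {linear V -> W}) :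
  continuous L -> (forall x, A x -> f x = L x) -> smooth_map A f.
Proof.
move=> cL fL x Ax; exists setT, L; split => //; first exact: openT.
- by apply: smooth_on_linear => //; exact: openT.
- by move=> y Ay _; rewrite fL.
Qed.

(** The sum, product and quotient rules keep directional derivatives inside this class, which makes
    it suitable for coinduction. Denominators must be nonzero on [U] only. *)
Inductive rational_on V (U : set V) : (V -> R) -> Prop :=
| rational_cst a : rational_on U (cst a)
| rational_linear (l : {linear V -> R}) : continuous l -> rational_on U l
| rational_add f g :
    rational_on U f -> rational_on U g -> rational_on U (f + g)
| rational_mul f g :
    rational_on U f -> rational_on U g -> rational_on U (f * g)
| rational_inv f : rational_on U f -> (forall x, U x -> f x != 0) ->
    rational_on U (fun x => (f x)^-1).

Lemma rational_differentiable V (U : set V) (f : V -> R) :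
  rational_on U f -> forall x, U x -> differentiable f x.
Proof.
elim=> [a|l cl|g h _ dg _ dh|g h _ dg _ dh|g _ dg g0] x Ux.
- exact: differentiable_cst.
- exact: linear_differentiable.
- by apply: differentiableD; [exact: dg|exact: dh].
- by apply: differentiableM; [exact: dg|exact: dh].
- by apply: differentiableV; [exact: dg|exact: g0].
Qed.

Lemma rational_derive V (U : set V) (f : V -> R) v :
  rational_on U f ->
  exists2 g, rational_on U g & forall x, U x -> 'D_v f x = g x.
Proof.
have derV h x : rational_on U h -> U x -> derivable h x v.
  by move=> rh Ux; apply: diff_derivable; exact: rational_differentiable Ux.
elim=> [a|l cl|g h rg [g' rg' Dg] rh [h' rh' Dh]
       |g h rg [g' rg' Dg] rh [h' rh' Dh]|g rg [g' rg' Dg] g0].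
- by exists (cst 0) => [|x _]; [constructor|rewrite derive_cst].
- exists (cst (l v)) => [|x _]; first by constructor.
  by rewrite deriveE ?diff_lin//; exact: linear_differentiable.
- exists (g' + h') => [|x Ux]; first by constructor.
  by rewrite deriveD ?Dg ?Dh//; exact: derV.
- exists (g * h' + h * g') => [|x Ux]; first by do !constructor.
  by rewrite deriveM ?Dg ?Dh//; exact: derV.
(* This is - g' / g^2, written as a product to stay within the class. *)
- exists (cst (-1) * ((fun x => (g x)^-1) * (fun x => (g x)^-1) * g')).
    by do ?[exact: rational_inv|constructor].
  move=> x Ux; rewrite deriveV; [|exact: g0|exact: derV].
  by rewrite Dg// !fctE /= expr2 invfM mulN1r scaleNr.
Qed.

Lemma rational_smooth_mx V (U : set V) m n (F : V -> 'M[R]_(m, n)) :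
  open U -> (forall i j, rational_on U (fun x => F x i j)) -> smooth_on U F.
Proof.
move=> oU rF.
have dC (f : V -> 'M[R]_(m, n)) :
    (forall i j, rational_on U (fun x => f x i j)) ->
    forall x, U x -> differentiable f x.
  move=> rf x Ux.
  (* The entries carry the dependence on [y]; the matrix units are constant. *)
  have -> : f = \sum_i \sum_j (fun y =>
      f y i j *: (delta_mx i j : 'M[R]_(m, n))).
    apply/funext => y; rewrite {1}(matrix_sum_delta (f y)) fct_sumE.
    by apply: eq_bigr => i _; rewrite fct_sumE.
  apply: differentiable_sum => i; apply: differentiable_sum => j.
  by apply: differentiableZl; exact: (rational_differentiable (rf i j)).
apply: (@smooth_on_coind _ _ _
  (fun f : V -> 'M[R]_(m, n) =>
    forall i j, rational_on U (fun x => f x i j))) => //.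
move=> f v rf.
have /choice[g hg] : forall ij : 'I_m * 'I_n, exists g, rational_on U g /\
    forall x, U x -> 'D_v (fun x => f x ij.1 ij.2) x = g x.
  by move=> ij; have [g] := rational_derive v (rf ij.1 ij.2); exists g.
exists (fun x => \matrix_(i, j) g (i, j) x) => [i j|x Ux].
  rewrite (_ : (fun _ => _) = g (i, j)); first by case: (hg (i, j)).
  by apply/funext => x; rewrite mxE.
rewrite derive_mx; last by apply: diff_derivable; exact: dC.
by apply/matrixP => i j; rewrite !mxE; case: (hg (i, j)) => _ /(_ x Ux).
Qed.

End Smoothness.

(** * Differentials of restricted linear maps, and global charts *)

Section Submanifolds.
Context {R : realType}.
Implicit Types V W : normedModType R.

(** Near 0 the curve stays in [X], so [f \o c] and [L \o c] coincide there. *)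
Lemma curve_differential V W (X : set V) (f : V -> W) (L : {linear V -> W})
    (x : V) (c : R -> V) :
  continuous L -> (forall y, X y -> f y = L y) -> curve_at X x c ->
  derive1 (f \o c) 0 = L (derive1 c 0).
Proof.
move=> cL fL [_ [J [oJ J0 sc Xc]]].
have dc : differentiable c 0 by exact: (sc [::]).
rewrite !derive1E -(derive_linear_comp _ cL)//; apply: near_eq_derive.
have : nbhs 0 J by exact: open_nbhs_nbhs.
by apply: filterS => t /Xc Xt; rewrite /= fL.
Qed.

(** Tangency provides a curve, and every curve with velocity [v] gives the same value [L v], so
    [xget] returns it and not its default. *)
Lemma differential_linear V W (X : set V) (f : V -> W)
    (L : {linear V -> W}) x v :
  continuous L -> (forall y, X y -> f y = L y) -> tangent X x v ->
  differential X f x v = L v.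
Proof.
move=> cL fL [c [cc cv]]; apply: xget_unique; first exists c.
  by rewrite (curve_differential cL fL cc) cv.
by move=> w [c' [cc' <- <-]]; rewrite (curve_differential cL fL cc').
Qed.

(** One global chart serves at every point: [pr], being linear, is a smooth inverse of [phi] on all
    of [X]. *)
Lemma submanifold_graph V d (X : set V) (O : set 'rV[R]_d) (phi : 'rV[R]_d -> V)
    (pr : {linear V -> 'rV[R]_d}) :
  open O -> smooth_on O phi -> phi @` O = X -> continuous pr ->
  (forall x, O x -> pr (phi x) = x) -> submanifold d X.
Proof.
move=> oO sphi imphi cpr prK x Xx; exists setT, O, phi; split => //.
  exact: openT.
split; last by exists pr; split => //; exact: smooth_map_linear.
- by move=> y Oy; exists O, phi.
- by rewrite setIT.
Qed.

End Submanifolds.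

Lemma ord2_ind (P : 'I_2 -> Prop) : P 0 -> P 1 -> forall i, P i.
Proof.
move=> P0 P1 [[|[|//]] lti].
  by rewrite (_ : Ordinal lti = 0)//; exact: val_inj.
by rewrite (_ : Ordinal lti = 1)//; exact: val_inj.
Qed.

Lemma ord3_ind (P : 'I_3 -> Prop) : P 0 -> P 1 -> P 2 -> forall i, P i.
Proof.
move=> P0 P1 P2 [[|[|[|//]]] lti].
- by rewrite (_ : Ordinal lti = 0)//; exact: val_inj.
- by rewrite (_ : Ordinal lti = 1)//; exact: val_inj.
- by rewrite (_ : Ordinal lti = 2)//; exact: val_inj.
Qed.

Lemma sum_ord3 (V : nmodType) (F : 'I_3 -> V) :
  \sum_(i < 3) F i = F 0 + F 1 + F 2.
Proof.
rewrite !big_ord_recl big_ord0 addr0 addrA.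
by congr (F _ + F _ + F _); exact: val_inj.
Qed.

(** * Symmetric matrices of determinant one *)

Section FlatTori.
Context {R : realType}.
Local Notation S := (@unit_volume_metrics R).

(** Indexing one list by [i + j] reduces the symmetry of the matrix to commutativity of addition. *)
Definition sym2 (a b c : R) : 'M[R]_2 :=
  \matrix_(i < 2, j < 2) [:: a; b; c]`_(i + j).

Lemma sym2E (G : 'M[R]_2) : G^T = G -> G = sym2 (G 0 0) (G 0 1) (G 1 1).
Proof.
move=> sG; have G10 : G 1 0 = G 0 1 by rewrite -[in LHS]sG mxE.
by apply/matrixP; elim/ord2_ind; elim/ord2_ind; rewrite mxE.
Qed.

Lemma det_sym2 a b c : \det (sym2 a b c) = a * c - b ^+ 2.
Proof.
rewrite (expand_det_row _ 0) !big_ord_recl big_ord0 /cofactor !det_mx11 !mxE /=.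
by ring.
Qed.

Lemma sym2_form a b c (x : 'rV[R]_2) :
  (x *m sym2 a b c *m x^T) 0 0 =
    a * x 0 0 ^+ 2 + 2 * b * x 0 0 * x 0 1 + c * x 0 1 ^+ 2.
Proof.
rewrite !mxE !big_ord_recl big_ord0 !mxE !big_ord_recl !big_ord0 !mxE /=.
have -> : lift ord0 ord0 = 1 :> 'I_2 by exact: val_inj.
by rewrite -[ord0]/(0 : 'I_2); ring.
Qed.

(** Sylvester's criterion: the form at (1, 0) equals a, and conversely a times the form is a square
    plus the determinant times a square. *)
Lemma unit_volume_sym2 a b c : S (sym2 a b c) <-> a * c - b ^+ 2 = 1 /\ 0 < a.
Proof.
split=> [[[_ pG] /[!det_sym2] dG]|[dG a0]].
  split=> //; have /pG : row2 1 0 != 0 :> 'rV[R]_2.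
    by apply/eqP => /rowP/(_ 0); rewrite !mxE /=; lra.
  by rewrite sym2_form !mxE /=; nra.
split; last by rewrite det_sym2.
split=> [|x x0]; first by apply/matrixP => i j; rewrite !mxE addnC.
rewrite sym2_form -(pmulr_rgt0 _ a0).
have -> : a * (a * x 0 0 ^+ 2 + 2 * b * x 0 0 * x 0 1 + c * x 0 1 ^+ 2) =
    (a * x 0 0 + b * x 0 1) ^+ 2 + (a * c - b ^+ 2) * x 0 1 ^+ 2 by ring.
rewrite dG mul1r.
have [x1|x1] := eqVneq (x 0 1) 0.
  have x00 : x 0 0 != 0.
    apply: contraNneq x0 => x00; apply/eqP/rowP.
    by elim/ord2_ind; rewrite mxE.
  by rewrite x1 mulr0 addr0 expr0n addr0 exprn_even_gt0//= mulf_neq0// gt_eqF.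
by rewrite ltr_wpDl ?sqr_ge0// exprn_even_gt0.
Qed.

Lemma invmx_sym2 a b c :
  a * c - b ^+ 2 = 1 -> invmx (sym2 a b c) = sym2 c (- b) a.
Proof.
move=> dG; have GK : sym2 c (- b) a *m sym2 a b c = 1%:M.
  apply/matrixP; elim/ord2_ind; elim/ord2_ind;
    by rewrite !mxE !big_ord_recl big_ord0 !mxE /= ?mulr1n ?mulr0n -?dG; ring.
have [_ uG] := mulmx1_unit GK.
by rewrite -[LHS]mul1mx -GK mulmxK.
Qed.

(** * Energies of the modes *)

Lemma differential_row_mode (m : int * int) x :
  differential_row (@mode R m) x = row2 m.1%:~R m.2%:~R.
Proof.
have lin : linear (mode m : 'rV[R]_2 -> R).
  by move=> k u v; rewrite /mode !mxE /GRing.scale /=; ring.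
pose isl := GRing.isLinear.Build _ _ _ _ _ lin.
pose l : {linear 'rV[R]_2 -> R} := HB.pack (mode m : 'rV[R]_2 -> R) isl.
have cl : continuous l by exact: mx_linear_continuous.
apply/rowP; elim/ord2_ind; rewrite !mxE -[mode m]/(l : _ -> _);
  rewrite deriveE ?diff_lin//;
  do ?exact: linear_differentiable;
  by rewrite /= /mode !mxE /= ?mulr1 ?mulr0 ?addr0 ?add0r.
Qed.

(** The integrand is constant because the mode is linear, and the unit square has measure 1. *)
Lemma mode_energyE (m : int * int) a b c : a * c - b ^+ 2 = 1 ->
  mode_energy m (sym2 a b c) =
    (c * m.1%:~R ^+ 2 - 2 * b * m.1%:~R * m.2%:~R + a * m.2%:~R ^+ 2) / 2.
Proof.
move=> dG; rewrite /mode_energy /energy det_sym2 dG sqrtr1.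
under eq_Rintegral do rewrite differential_row_mode mulr1.
rewrite Rintegral_cst; last by apply: measurableX; exact: measurable_itv.
have l01 : @lebesgue_measure R `[0, 1] = 1%E.
  by rewrite lebesgue_measure_itv /= lte_fin ltr01 oppr0 adde0.
have mu01 : ((@lebesgue_measure R) \x (@lebesgue_measure R))%E
    (`[0, 1] `*` `[0, 1]) = 1%E.
  rewrite product_measure1E; [|exact: measurable_itv|exact: measurable_itv].
  by rewrite -[1%E]mule1 -[in RHS]l01.
rewrite [X in fine X]mu01 /= mulr1.
by rewrite /conorm_sq invmx_sym2// sym2_form !mxE /=; field.
Qed.

(** * The linear form of [Theta] and its inverse *)

Definition energies (G : 'M[R]_2) : 'rV[R]_3 :=
  row3 (G 1 1 / 2) (G 0 0 / 2) ((G 0 0 + G 1 1) / 2 - G 0 1).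

Fact energies_is_linear : linear energies.
Proof.
move=> k A B; apply/rowP; elim/ord3_ind; rewrite !mxE /= ?mxE; lra.
Qed.
HB.instance Definition _ :=
  GRing.isLinear.Build R 'M[R]_2 'rV[R]_3 _ energies energies_is_linear.

(** Polarization: p + q - r recovers the off-diagonal entry. Since [energies] ignores [G 1 0],
    applying [gram] after it gives back symmetric matrices only. *)
Definition gram (y : 'rV[R]_3) : 'M[R]_2 :=
  sym2 (2 * y 0 1) (y 0 0 + y 0 1 - y 0 2) (2 * y 0 0).

Fact gram_is_linear : linear gram.
Proof.
move=> k A B; apply/matrixP; elim/ord2_ind; elim/ord2_ind; rewrite !mxE /=; lra.
Qed.
HB.instance Definition _ :=
  GRing.isLinear.Build R 'rV[R]_3 'M[R]_2 _ gram gram_is_linear.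

Lemma energies_sym2 a b c :
  energies (sym2 a b c) = row3 (c / 2) (a / 2) ((a + c) / 2 - b).
Proof. by rewrite /energies !mxE. Qed.

Lemma energiesK (G : 'M[R]_2) : G^T = G -> gram (energies G) = G.
Proof.
move=> /sym2E ->; rewrite energies_sym2 /gram !mxE /=.
by congr sym2; lra.
Qed.

Lemma gramK y : energies (gram y) = y.
Proof.
by rewrite energies_sym2; apply/rowP; elim/ord3_ind; rewrite !mxE /=; lra.
Qed.

Lemma Theta_linear (G : 'M[R]_2) : S G -> Theta G = energies G.
Proof.
move=> SG; have [[sG _] _] := SG; move: SG; rewrite (sym2E sG).
move=> /unit_volume_sym2[dG _]; rewrite energies_sym2 /Theta !mode_energyE//=.
by congr row3; rewrite /intmul /=; field.
Qed.

(** * Orthogonal coordinates and the hyperboloid *)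

Definition UVWmx : 'M[R]_3 :=
  \matrix_(i < 3, j < 3)
    [:: [:: 1; 1; 1]`_i / Num.sqrt 3; [:: 1; -1; 0]`_i / Num.sqrt 2;
        [:: 1; 1; -2]`_i / Num.sqrt 6]`_j.

Lemma UVWE (y : 'rV[R]_3) : UVW y = y *m UVWmx.
Proof.
apply/rowP; elim/ord3_ind; rewrite !mxE sum_ord3 !mxE /=; ring.
Qed.

Lemma UVWmx_orthogonal : UVWmx *m UVWmx^T = 1%:M.
Proof.
have sq n (x y : R) : (0 < n)%N ->
    x / Num.sqrt n%:R * (y / Num.sqrt n%:R) = x * y / n%:R.
  by move=> n0; rewrite mulrACA -invfM -expr2 sqr_sqrtr.
by apply/matrixP; elim/ord3_ind; elim/ord3_ind;
  rewrite !mxE sum_ord3 !mxE /= !sq// ?mulr1n ?mulr0n; field.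
Qed.

(** Squaring removes the roots, and (p + q + r)^2 / 3 - (p - q)^2 - (p + q - 2 r)^2 / 3 expands to
    the determinant of [gram (row3 p q r)]. *)
Lemma HR_UVW (p q r : R) :
  HR (UVW (row3 p q r)) <-> 4 * p * q - (p + q - r) ^+ 2 = 1 /\ 0 < p + q + r.
Proof.
rewrite /HR /UVW /= !mxE /= !exprMn !exprVn !sqr_sqrtr// pmulr_lgt0; last first.
  by rewrite invr_gt0 sqrtr_gt0.
rewrite (_ : _ - _ - _ = 4 * p * q - (p + q - r) ^+ 2)//.
by field.
Qed.

(* If q <= 0 then p < 0, and r - p - q > - 2 (p + q) > 0 yields
   (p + q - r)^2 > 4 (p + q)^2 >= 16 p q. *)
Lemma cone_gt0 (p q r : R) :
  0 < p + q + r -> 4 * p * q - (p + q - r) ^+ 2 = 1 -> 0 < q.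
Proof.
move=> s0 d0; rewrite ltNge; apply/negP => q0; have sq := sqr_ge0 (p + q - r).
have p0 : p < 0.
  by rewrite ltNge; apply/negP => p0; have := mulr_ge0_le0 p0 q0; lra.
have : 0 < (r - p - q + 2 * (p + q)) * (r - p - q - 2 * (p + q)).
  by apply: mulr_gt0; lra.
by have := sqr_ge0 (p - q); lra.
Qed.

Lemma HR_image : UVW @` (energies @` S) = HR.
Proof.
apply/seteqP; split=> [_ [_ [G SG <-] <-]|y Hy].
  have [[sG _] _] := SG; move: SG; rewrite (sym2E sG) => /unit_volume_sym2.
  move: (G 0 0) (G 0 1) (G 1 1) => a b c [dG a0].
  rewrite energies_sym2 HR_UVW; split; first by rewrite -[RHS]dG; field.
  have c0 : 0 < c by rewrite -(pmulr_rgt0 _ a0); nra.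
  (* The sum p + q + r is a + c - b, positive because (a + c)^2 >= 4 a c > b^2. *)
  by nra.
have yE : y = UVW (y *m UVWmx^T).
  by rewrite UVWE -mulmxA (mulmx1C UVWmx_orthogonal) mulmx1.
set z := y *m UVWmx^T in yE; exists z; last by [].
exists (gram z); last exact: gramK.
have zE : z = row3 (z 0 0) (z 0 1) (z 0 2).
  by apply/rowP; elim/ord3_ind; rewrite [RHS]mxE.
move: Hy; rewrite yE zE => /HR_UVW; rewrite /gram -zE.
move: (z 0 0) (z 0 1) (z 0 2) => p q r [d0 s0].
apply/unit_volume_sym2; split; first by rewrite -[RHS]d0; ring.
(* The upper left entry is 2 q, whose sign is decided by the choice of sheet. *)
by rewrite mulr_gt0//; exact: cone_gt0 s0 d0.
Qed.

(** * A global rational chart on the half-plane *)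

Definition metric_chart (x : 'rV[R]_2) : 'M[R]_2 :=
  sym2 (x 0 0) (x 0 1) ((1 + x 0 1 ^+ 2) / x 0 0).

Definition chart_dom : set 'rV[R]_2 := [set x | 0 < x 0 0].

Definition chart_inv (G : 'M[R]_2) : 'rV[R]_2 := row2 (G 0 0) (G 0 1).

Fact chart_inv_is_linear : linear chart_inv.
Proof.
by move=> k A B; apply/rowP; elim/ord2_ind; rewrite !mxE.
Qed.
HB.instance Definition _ :=
  GRing.isLinear.Build R 'M[R]_2 'rV[R]_2 _ chart_inv chart_inv_is_linear.

Lemma open_chart_dom : open chart_dom.
Proof.
apply: (@open_comp _ _ (fun x : 'rV[R]_2 => x 0 0) [set t : R | 0 < t]).
  by move=> x _; exact: coord_continuous.
exact: open_gt.
Qed.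

Lemma chartK x : chart_inv (metric_chart x) = x.
Proof. by apply/rowP; elim/ord2_ind; rewrite !mxE. Qed.

Lemma chart_image : metric_chart @` chart_dom = S.
Proof.
apply/seteqP; split=> [_ [x x0 <-]|G SG].
  apply/unit_volume_sym2; split=> //; field.
  exact: lt0r_neq0.
have [[sG _] _] := SG; move: SG; rewrite (sym2E sG) => /unit_volume_sym2[dG a0].
exists (row2 (G 0 0) (G 0 1)); first by rewrite /chart_dom /= mxE.
rewrite /metric_chart !mxE /=; congr sym2.
by rewrite -[X in X + _]dG subrK mulrAC divff ?mul1r ?lt0r_neq0.
Qed.

Lemma rational_coord (U : set 'rV[R]_2) i : rational_on U (fun x => x 0 i).
Proof.
have lin : linear (fun x : 'rV[R]_2 => x 0 i) by move=> k u v; rewrite !mxE.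
pose isl := GRing.isLinear.Build _ _ _ _ _ lin.
pose l : {linear 'rV[R]_2 -> R} := HB.pack (fun x : 'rV[R]_2 => x 0 i) isl.
by apply: (@rational_linear _ _ U l); exact: mx_linear_continuous.
Qed.

(** The only denominator is [x 0 0], which is positive on [chart_dom]. *)
Lemma smooth_chart : smooth_on chart_dom metric_chart.
Proof.
apply: rational_smooth_mx; first exact: open_chart_dom.
pose c0 := fun x : 'rV[R]_2 => x 0 0; pose c1 := fun x : 'rV[R]_2 => x 0 1.
have r0 : rational_on chart_dom c0 by exact: rational_coord.
have r1 : rational_on chart_dom c1 by exact: rational_coord.
have r2 : rational_on chart_dom (fun x => (1 + x 0 1 ^+ 2) / x 0 0).
  rewrite (_ : (fun _ => _) = (cst 1 + c1 * c1) * (fun x => (c0 x)^-1)).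
    apply: rational_mul.
      by apply: rational_add; [exact: rational_cst|exact: rational_mul].
    by apply: rational_inv => // x; exact: lt0r_neq0.
  by apply/funext => x; rewrite !fctE expr2.
have rE (i j : 'I_2) f : rational_on chart_dom f ->
    (forall x, metric_chart x i j = f x) ->
    rational_on chart_dom (fun x => metric_chart x i j).
  by move=> rf /funext ->.
elim/ord2_ind; elim/ord2_ind.
- by apply: (rE _ _ _ r0) => x; rewrite mxE.
- by apply: (rE _ _ _ r1) => x; rewrite mxE.
- by apply: (rE _ _ _ r1) => x; rewrite mxE.
- by apply: (rE _ _ _ r2) => x; rewrite mxE.
Qed.

(** Transposition is linear and agrees with the identity on [S], so it fixes the velocities of
    curves in [S]. *)
Lemma tangent_sym (G v : 'M[R]_2) : tangent S G v -> v^T = v.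
Proof.
move=> [c [cc <-]].
have symS y : S y -> id y = (trmx y : 'M[R]_2) by move=> [[]].
rewrite -[LHS](curve_differential _ symS cc)//.
exact: mx_linear_continuous.
Qed.

Lemma submanifold_unit_volume : submanifold 2 S.
Proof.
apply: (submanifold_graph (pr := chart_inv) open_chart_dom smooth_chart
  chart_image).
  exact: mx_linear_continuous.
by move=> x _; exact: chartK.
Qed.

(** The chart of the metrics is transported by the linear map [L]; [K] undoes the orthogonal map and
    [energies], then projects to the half-plane coordinates. *)
Lemma submanifold_HR : submanifold 2 (@HR R).
Proof.
pose L : {linear 'M[R]_2 -> 'rV[R]_3} := mulmxr UVWmx \o energies.
pose K : {linear 'rV[R]_3 -> 'rV[R]_2} := chart_inv \o gram \o mulmxr UVWmx^T.
apply: (@submanifold_graph _ _ _ _ chart_dom (L \o metric_chart) K).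
- exact: open_chart_dom.
- apply: smooth_on_linear_comp.
  + exact: open_chart_dom.
  + exact: mx_linear_continuous.
  + exact: smooth_chart.
- rewrite -image_comp chart_image -HR_image image_comp.
  by congr image; apply/funext => y; rewrite /= UVWE.
- exact: mx_linear_continuous.
move=> x _; rewrite /K /L /= -mulmxA UVWmx_orthogonal mulmx1.
rewrite energiesK ?chartK//.
by apply/matrixP => i j; rewrite !mxE addnC.
Qed.

End FlatTori.

(** * Embedding, image and isometry *)

Theorem proposition9p2 (R : realType) :
  [/\ @orthogonal_map R 3 UVW,
      smooth_embedding 2 (@unit_volume_metrics R) Theta,
      UVW @` (Theta @` (@unit_volume_metrics R)) = HR &
      riemannian_isometry 2 (@unit_volume_metrics R) gR HR euclidean (UVW \o Theta)].
Proof.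
have cE : continuous (@energies R) by exact: mx_linear_continuous.
pose L : {linear 'M[R]_2 -> 'rV[R]_3} := mulmxr UVWmx \o energies.
have cL : continuous L by exact: mx_linear_continuous.
have LE G : unit_volume_metrics G -> (UVW \o Theta) G = L G.
  by move=> SG; rewrite /= UVWE Theta_linear.
have dE := differential_linear cE (@Theta_linear R).
have imE : UVW @` (Theta @` (@unit_volume_metrics R)) = HR.
  rewrite -HR_image; congr image; apply: eq_imagel => G SG; exact: Theta_linear.
split=> //.
- by exists UVWmx; [exact: UVWmx_orthogonal|exact: UVWE].
- split; first exact: submanifold_unit_volume.
    split=> [|G SG v w].
      exact: smooth_map_linear cE (@Theta_linear R).
    rewrite !inE => tv tw.
    (* Tangent vectors are symmetric matrices, on which [gram] inverts the differential
       [energies]. *)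
    rewrite !dE// => /(congr1 gram).
    by rewrite !energiesK ?(tangent_sym tv) ?(tangent_sym tw).
  split.
    apply: (@subspace_eq_continuous _ _ _ energies) => [G /set_mem SG|].
      by exact: esym (Theta_linear SG).
    exact: continuous_subspaceT.
  exists gram; split.
    by apply: continuous_subspaceT; exact: mx_linear_continuous.
  by move=> G SG; rewrite Theta_linear// energiesK//; case: SG => -[].
- split; [exact: submanifold_unit_volume|exact: submanifold_HR| |].
    split; first exact: smooth_map_linear cL LE.
      by rewrite -imE image_comp.
    pose K : {linear 'rV[R]_3 -> 'M[R]_2} := gram \o mulmxr UVWmx^T.
    exists K; split.
      apply: (@smooth_map_linear _ _ _ _ _ K) => //.
      exact: mx_linear_continuous.
    move=> G SG; rewrite LE// /K /L /= -mulmxA UVWmx_orthogonal mulmx1.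
    rewrite energiesK//.
    by case: SG => -[].
  move=> G v w SG tv tw; rewrite /gR /pullback !dE//.
  rewrite !(differential_linear cL LE)//.
  (* As matrix products, the inner products of vectors mapped by [L] contain [UVWmx *m UVWmx^T], the
     identity, in the middle. *)
  have dot (x y : 'rV[R]_3) z : euclidean z x y = (x *m y^T) 0 0.
    by rewrite mxE; apply: eq_bigr => i _; rewrite mxE.
  rewrite !dot /L /= trmx_mul mulmxA -[_ *m _ *m UVWmx^T]mulmxA.
  by rewrite UVWmx_orthogonal mulmx1.
Qed.
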